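(* Let $A$ be a unital Banach algebra with unit $1_A$, and let $(c_n)_{n\in\mathbb{Z}}$ be a bounded cosine sequence in $A$, i.e. $c_0=1_A$, $c_{m+n}+c_{m-n}=2c_mc_n$ for all $m,n\in\mathbb{Z}$, and $\sup_{n}\Vert c_n\Vert<\infty$. Assume that the spectrum of $c_1$ is a singleton. Then $(c_n)_{n\ge1}$ is a scalar sequence, and there exists $b\in\mathbb{R}$ such that $c_n=\cos(nb)1_A$ for all $n\ge 1$. *)

(* Defs.v *)
From HB Require Import structures.
From mathcomp Require Import all_boot all_order all_algebra.
From mathcomp Require Import all_classical all_reals.
From mathcomp Require Import topology normedtype trigo.
From mathcomp Require Export complex.
Set Implicit Arguments. Unset Strict Implicit. Unset Printing Implicit Defensive.
Import Order.TTheory GRing.Theory Num.Theory numFieldNormedType.Exports.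
Local Open Scope ring_scope.
Local Open Scope complex_scope.

Record unital_banach_algebra (R : realType)
    (A : completeNormedModType R[i]) (mul : A -> A -> A) (one : A) : Prop := {
  uba_mulA : forall x y z, mul x (mul y z) = mul (mul x y) z;
  uba_mul1l : forall x, mul one x = x;
  uba_mul1r : forall x, mul x one = x;
  uba_mulDl : forall x y z, mul (x + y) z = mul x z + mul y z;
  uba_mulDr : forall x y z, mul x (y + z) = mul x y + mul x z;
  uba_mulZl : forall (k : R[i]) x y, mul (k *: x) y = k *: mul x y;
  uba_mulZr : forall (k : R[i]) x y, mul x (k *: y) = k *: mul x y;
  uba_norm_mul : forall x y, `|mul x y| <= `|x| * `|y|;
  uba_norm1 : `|one| = 1
}.

Definition invertible (R : realType) (A : completeNormedModType R[i])
    (mul : A -> A -> A) (one : A) (x : A) : Prop :=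
  exists y : A, mul x y = one /\ mul y x = one.

Definition spectrum (R : realType) (A : completeNormedModType R[i])
    (mul : A -> A -> A) (one : A) (x : A) : set R[i] :=
  [set lam | ~ invertible mul one (x - lam *: one)].

Definition bounded_cosine_sequence (R : realType) (A : completeNormedModType R[i])
    (mul : A -> A -> A) (one : A) (c : int -> A) : Prop :=
  [/\ c 0 = one,
      (forall m n : int, c (m + n) + c (m - n) = 2%:R *: mul (c m) (c n)) &
      exists M : R, forall n : int, `|c n| <= M%:C].

(* Main.v *)
(* Let x = c_1 and R(z) = (z - x)^-1, which exists for z <> lam. For z off the real
   axis write z = (r + 1/r)/2 with |r| < 1; then (1 - r^2)/(1 - 2rx + r^2) is the
   Poisson kernel 1 + 2 sum_n r^n c_n, and the boundedness of c gives
   |R(z)| <= 2M / |Im z|. Put a = Re lam and q = x - a. Near a circle of positive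
   radius around a, R is bounded: off the real axis by this estimate, near the two
   real points by perturbation. Averaging R over roots of unity on such circles
   (Rickart's form of the spectral radius formula) shows that q is quasinilpotent.
   Finally, with y = q/rho and z = a + rho w,
     y = (1/2 pi i) int_{|w| = 1} (w^2 - 1) rho R(z) dw/w,
   where the weight -1 contributes nothing by quasinilpotence; since |w^2 - 1| = 2 |Im w|, this yields |q| = O(rho) for all
   rho > 0, so q = 0. Then x = a is a real scalar, and boundedness of the
   Chebyshev recursion forces |a| <= 1, a = cos b. *)
Require Import Defs.
From HB Require Import structures.
From mathcomp Require Import all_boot all_order all_algebra.
From mathcomp Require Import all_classical all_reals.
From mathcomp Require Import topology normedtype sequences trigo complex.
From mathcomp Require Import cyclic separable cyclotomic.
From mathcomp Require Import ring lra zify.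
Import Order.TTheory GRing.Theory Num.Theory numFieldNormedType.Exports.
Local Open Scope ring_scope.
Local Open Scope complex_scope.
Local Open Scope classical_set_scope.
Set Implicit Arguments.
Unset Strict Implicit.

(** * Primitive roots of unity and the real-valued modulus on [R[i]] *)

(** As [n] is nonzero in [F], X^n - 1 is separable, and n distinct n-th roots of unity include a
    primitive one. *)
Lemma closed_field_prim_root (F : closedFieldType) (n : nat) :
  n%:R != 0 :> F -> exists w : F, n.-primitive_root w.
Proof.
move=> nF; have n0 : (0 < n)%N by case: n nF => //; rewrite eqxx.
have [r] := closed_field_poly_normal ('X^n - 1 : {poly F}).
rewrite (monicP (monicXnsubC 1 n0)) scale1r => Er.
suff /hasP[w _ wn] : has n.-primitive_root r by exists w.
apply: has_prim_root => //.
- by apply/allP => w wr; rewrite -[_.-unity_root _]/(root _ _) Er root_prod_XsubC.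
- by rewrite -separable_prod_XsubC -Er separable_Xn_sub_1.
- by have := size_XnsubC (1 : F) n0; rewrite Er size_prod_XsubC => -[->].
Qed.

Section Modulus.
Variables (R : realType).
Implicit Types z w : R[i].

Definition modc z : R := complex.Re `|z|.

Lemma modcE z : `|z| = (modc z)%:C.
Proof. by rewrite /modc normc_def. Qed.

Lemma sqr_modc z : modc z ^+ 2 = complex.Re z ^+ 2 + complex.Im z ^+ 2.
Proof. by apply: complexI; rewrite rmorphXn /= -modcE -add_Re2_Im2. Qed.

Lemma modc_ge0 z : 0 <= modc z.
Proof. by rewrite -ler0c -modcE. Qed.

Lemma modcM z w : modc (z * w) = modc z * modc w.
Proof. by apply: complexI; rewrite rmorphM /= -!modcE normrM. Qed.

Lemma modcD z w : modc (z + w) <= modc z + modc w.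
Proof. by rewrite -lecR rmorphD /= -!modcE ler_normD. Qed.

Lemma modcN z : modc (- z) = modc z.
Proof. by apply: complexI; rewrite -!modcE normrN. Qed.

Lemma modc1 : modc 1 = 1.
Proof. by apply: complexI; rewrite -modcE normr1. Qed.

Lemma modcX z n : modc (z ^+ n) = modc z ^+ n.
Proof. by apply: complexI; rewrite rmorphXn /= -!modcE normrX. Qed.

Lemma modc_real (x : R) : modc x%:C = `|x|.
Proof. by rewrite /modc normc_def /= expr0n addr0 sqrtr_sqr. Qed.

Lemma natc_neq0 (n : nat) : (0 < n)%N -> n%:R != 0 :> R[i].
Proof. by rewrite pnatr_eq0 -lt0n. Qed.

(** The roots z + s and z - s of r^2 - 2zr + 1 have product 1. If neither lies in the open unit
    disc, both lie on the circle and are conjugate, so their sum 2z is real. *)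
Lemma joukowski_preimage z : complex.Im z != 0 ->
  exists2 r : R[i], r ^+ 2 + 1 = 2%:R * z * r & modc r < 1.
Proof.
move=> zim.
pose s := sqrtc (z ^+ 2 - 1).
have s2 : s ^+ 2 = z ^+ 2 - 1 by apply: sqr_sqrtc.
have e1 : (z + s) ^+ 2 + 1 = 2%:R * z * (z + s) by ring: s2.
have e2 : (z - s) ^+ 2 + 1 = 2%:R * z * (z - s) by ring: s2.
have e3 : (z + s) * (z - s) = 1 by ring: s2.
have [l1|g1] := ltrP (modc (z + s)) 1; first by exists (z + s).
have [l2|g2] := ltrP (modc (z - s)) 1; first by exists (z - s).
have m3 : modc (z + s) * modc (z - s) = 1 by rewrite -modcM e3 modc1.
have m1 : modc (z + s) = 1 by nra.
have m2 : modc (z + s) ^+ 2 = 1 by rewrite m1 expr1n.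
have e4 : z *+ 2 = (z + s) + (z - s) by ring.
move: m2 e3 e4 zim; rewrite sqr_modc.
move: (z + s) (z - s) => P Q {e1 e2 s2 g1 g2 m3 m1}.
case: P Q z {s} => p q [u v] [a b] /= pq1 [e5 e6] [_ e7] /eqP[].
have ev : v = - q.
  transitivity (v * (p ^+ 2 + q ^+ 2)); first by rewrite pq1 mulr1.
  transitivity (p * (p * v + q * u) - q * (p * u - q * v)); first by ring.
  by rewrite e5 e6; ring.
lra.
Qed.

(** On the circle |w^2 - 1| = |w - 1/w|, and 1/w is the conjugate of w. *)
Lemma modc_sqrB1 (w : R[i]) : modc w = 1 ->
  modc (w ^+ 2 - 1) = 2 * `|complex.Im w|.
Proof.
move=> w1.
have m : modc w ^+ 2 = 1 by rewrite w1 expr1n.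
apply/eqP; rewrite -(@eqrXn2 _ 2) ?modc_ge0 ?mulr_ge0 //.
move: m; rewrite !sqr_modc exprMn real_normK ?num_real //.
case: w {w1} => a b /= m.
apply/eqP; rewrite expr2 /=.
have -> : a * a - b * b - 1 = - 2 * b ^+ 2 by rewrite -[X in _ - X]m; ring.
transitivity (2 ^+ 2 * b ^+ 2 * (a ^+ 2 + b ^+ 2)); first by ring.
by rewrite m mulr1.
Qed.

(** With t = |z| and a = Re z, the squares of the two sides are 2t(t - sa) and 4(t - sa)(t + sa);
    they differ by 2(t - sa)(t + 2sa) >= 0. *)
Lemma dist_real_modulus (z : R[i]) (s : R) : s = 1 \/ s = -1 ->
  0 <= s * complex.Re z -> modc (z - (s * modc z)%:C) <= 2 * `|complex.Im z|.
Proof.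
move=> ss sz.
have := sqr_modc z; have := modc_ge0 z; move: (modc z) => t t0 tz.
rewrite -(@ler_pXn2r _ 2) ?nnegrE ?modc_ge0 ?mulr_ge0 //.
rewrite sqr_modc exprMn real_normK ?num_real //.
case: z tz sz => a b /= tz sz.
have ta : s * a <= t.
  rewrite -(@ler_pXn2r _ 2) ?nnegrE // tz; case: ss => ->; nra.
have ss1 : s * s = 1 by case: ss => ->; ring.
have h : 0 <= (t - s * a) * (t + 2 * (s * a)) by apply: mulr_ge0; lra.
case: ss ta h sz {ss1} => -> ta h sz; nra.
Qed.

End Modulus.

(** * Geometric error terms, algebra norms and the Poisson bound on the resolvent *)

Lemma geom_small (R : realType) (t K e : R) : 0 <= t -> t < 1 -> 0 < e ->
  exists N : nat, K * t ^+ N < e.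
Proof.
move=> t0 t1 e0.
have h : (K * t ^+ n) @[n --> \oo] --> (K * 0 : R).
  by apply: cvgMr; apply: cvg_expr; rewrite ger0_norm.
rewrite mulr0 in h.
have [N _ hN] := (cvgr0Pnorm_lt _).1 h _ e0.
exists N; apply: le_lt_trans (ler_norm _) _; exact: (hN N (leqnn N)).
Qed.

Lemma le_geom (R : realType) (t K a b : R) : 0 <= t -> t < 1 ->
  (forall N : nat, a <= b + K * t ^+ N) -> a <= b.
Proof.
move=> t0 t1 h; rewrite leNgt; apply/negP => ba.
have e0 : 0 < a - b by rewrite subr_gt0.
have [N hN] := geom_small K t0 t1 e0.
by have := h N; lra.
Qed.

Record algebra_norm (R : realType) (T : algType R[i]) (nr : T -> R) : Prop := {
  anormD : forall x y, nr (x + y) <= nr x + nr y;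
  anormZ : forall k x, nr (k *: x) = modc k * nr x;
  anormM : forall x y, nr (x * y) <= nr x * nr y;
  anorm1 : nr 1 = 1;
  anorm0_eq0 : forall x, nr x = 0 -> x = 0
}.

Section NormedAlgebra.
Variables (R : realType) (T : algType R[i]) (nr : T -> R).
Variable an : algebra_norm nr.
Implicit Types (x y q u v e : T) (z w : R[i]).

Lemma anorm0 : nr 0 = 0.
Proof. by rewrite -(scale0r (1 : T)) (anormZ an) modc_real normr0 mul0r. Qed.

Lemma anormN x : nr (- x) = nr x.
Proof. by rewrite -scaleN1r (anormZ an) modcN modc1 mul1r. Qed.

Lemma anormB x y : nr (x - y) <= nr x + nr y.
Proof. by rewrite -(anormN y) (anormD an). Qed.

Lemma anorm_ge0 x : 0 <= nr x.
Proof. by have := anormB x x; rewrite subrr anorm0; lra. Qed.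

Lemma anormX x n : nr (x ^+ n) <= nr x ^+ n.
Proof.
elim: n => [|n IH]; first by rewrite !expr0 (anorm1 an).
by rewrite !exprS (le_trans (anormM an _ _)) // ler_wpM2l ?anorm_ge0.
Qed.

Lemma anorm_sum (I : finType) (F : I -> T) (G : I -> R) :
  (forall i, nr (F i) <= G i) -> nr (\sum_i F i) <= \sum_i G i.
Proof.
move=> FG; apply: (big_ind2 (fun u r => nr u <= r)) => //.
  by rewrite anorm0.
by move=> u1 r1 u2 r2 h1 h2; apply: le_trans (anormD an _ _) (lerD h1 h2).
Qed.

(* The first factor is a partial sum of the Poisson kernel 1 + 2 sum_n r^n c_n. *)
Lemma poisson_mul (c : nat -> T) x z (r : R[i]) (N : nat) :
  c 0%N = 1 -> c 1%N = x ->
  (forall n, c n.+2 + c n = 2%:R *: (c n.+1 * x)) ->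
  r ^+ 2 + 1 = 2%:R * z * r ->
  (1 + \sum_(i < N) (2%:R * r ^+ i.+1) *: c i.+1) * ((2%:R * r) *: (z%:A - x)) =
  (1 - r ^+ 2)%:A - (2%:R * r ^+ N.+1) *: c N.+1 + (2%:R * r ^+ N.+2) *: c N.
Proof.
move=> c0 c1 crec rz.
have eD : (2%:R * r) *: (z%:A - x) = (1 + r ^+ 2)%:A - (2%:R * r) *: x.
  rewrite scalerBr scalerA; congr (_ *: _ - _).
  by rewrite -[RHS]addrC rz; ring.
elim: N => [|N IH].
  rewrite big_ord0 addr0 mul1r eD expr1 c0 c1 addrAC -scalerDl; congr (_ *: _ - _).
  by ring.
rewrite big_ord_recr /= addrA mulrDl IH eD mulrBr -!scalerAl -!scalerAr mulr1.
rewrite (mulrC 2%:R r) -[(r * 2%:R) *: _]scalerA -crec !scalerDr !scalerA.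
set p := _ *: c N.+1; set k := _%:A; set s := _ *: c N; set h := _ *: c N.+1.
set d := _ *: c N.+2; set s' := _ *: c N.
have -> : s' = s by rewrite /s' /s; congr (_ *: _); rewrite !exprS; ring.
have -> : h = p + (2%:R * r ^+ N.+3) *: c N.+1.
  by rewrite /h /p -scalerDl; congr (_ *: _); rewrite !exprS; ring.
have -> : d = (2%:R * r ^+ N.+2) *: c N.+2.
  by rewrite /d; congr (_ *: _); rewrite !exprS; ring.
move: (_ *: c N.+1) (_ *: c N.+2) => h1 d1.
rewrite opprD !addrA [LHS](ACl (1*6*5*2*4*3*7))%R /=.
by rewrite subrK addrK.
Qed.
(* With z = (r + 1/r)/2 and |r| < 1, the Poisson kernel gives
   |z-x|^-1 <= M (2|r| / |1-r^2|) (1+|r|)/(1-|r|), and the right-hand side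
   is at most 2M / |Im z|. *)
Lemma resolvent_bound (c : nat -> T) x z v (M : R) :
  c 0%N = 1 -> c 1%N = x ->
  (forall n, c n.+2 + c n = 2%:R *: (c n.+1 * x)) ->
  (forall n, nr (c n) <= M) ->
  complex.Im z != 0 -> (z%:A - x) * v = 1 ->
  nr v * `|complex.Im z| <= 2 * M.
Proof.
move=> c0 c1 crec cM z0 zv.
have [r rz r1] := joukowski_preimage z0.
set t := modc r in r1.
have t0 : 0 <= t := modc_ge0 r.
have M1 : 1 <= M by have := cM 0%N; rewrite c0 (anorm1 an).
have m2 : modc (2%:R : R[i]) = 2.
  by rewrite -(rmorph_nat (real_complex R)) modc_real ger0_norm.
have v0 := anorm_ge0 v.
pose P N := 1 + \sum_(i < N) (2%:R * r ^+ i.+1) *: c i.+1.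
(* |P_N| is at most 1 + 2M(t + ... + t^N); as 1 <= M, the leading 1 may be replaced by M, and the
   factor 1 - t clears the geometric sum. *)
have nP N : (1 - t) * nr (P N) <= M * (1 + t) - 2 * M * t ^+ N.+1.
  elim: N => [|N IH].
    have p0 : 0 <= (M - 1) * (1 - t) by apply: mulr_ge0; lra.
    by rewrite /P big_ord0 addr0 (anorm1 an) expr1; lra.
  rewrite /P big_ord_recr /= addrA -/(P N).
  have h := anormD an (P N) ((2%:R * r ^+ N.+1) *: c N.+1).
  have h' : nr ((2%:R * r ^+ N.+1) *: c N.+1) <= 2 * t ^+ N.+1 * M.
    by rewrite (anormZ an) modcM m2 modcX -/t ler_wpM2l ?mulr_ge0 ?exprn_ge0.
  have h3 : (1 - t) * nr (P N + (2%:R * r ^+ N.+1) *: c N.+1)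
      <= (1 - t) * (nr (P N) + 2 * t ^+ N.+1 * M).
    by apply: ler_wpM2l; lra.
  by rewrite [t ^+ N.+2]exprS; nra.
(* Multiplying the truncated kernel identity by [v] on the right cancels z - x; the two boundary
   terms are O(t^N). *)
have key N : modc (1 - r ^+ 2) * nr v * (1 - t) <=
    2 * t * (M * (1 + t)) + (4 * M * nr v) * t ^+ N.
  have e1 := congr1 ( *%R^~ v) (poisson_mul N c0 c1 crec rz).
  rewrite -/(P N) /= -mulrA -scalerAl zv -scalerAr mulr1 (mulrDl _ _ v) mulrBl in e1.
  rewrite -!scalerAl mul1r in e1.
  set a1 := _ *: (c N.+1 * v) in e1; set a2 := _ *: (c N * v) in e1.
  have e2 : (1 - r ^+ 2) *: v = (2%:R * r) *: P N + a1 - a2.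
    by rewrite e1 (addrAC _ a2) subrK addrK.
  have tN0 : 0 <= t ^+ N by rewrite exprn_ge0.
  have tN1 : t ^+ N.+1 <= t ^+ N by rewrite exprS ler_piMl // ltW.
  have tN2 : t ^+ N.+2 <= t ^+ N by rewrite exprS (le_trans _ tN1) // ler_piMl ?exprn_ge0 // ltW.
  have cv n : nr (c n * v) <= M * nr v.
    by apply: le_trans (anormM an _ _) _; rewrite ler_wpM2r.
  have Mv : 0 <= M * nr v by apply: mulr_ge0 => //; lra.
  have na k n : t ^+ k <= t ^+ N ->
      nr ((2%:R * r ^+ k) *: (c n * v)) <= 2 * t ^+ N * (M * nr v).
    move=> tk; rewrite (anormZ an) modcM m2 modcX.
    apply: ler_pM (cv n); rewrite ?anorm_ge0 ?ler_pM2l //.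
    by rewrite mulr_ge0 ?exprn_ge0.
  have n1 : nr a1 <= 2 * t ^+ N * (M * nr v) by apply: na.
  have n2 : nr a2 <= 2 * t ^+ N * (M * nr v) by apply: na.
  have n3 : modc (1 - r ^+ 2) * nr v <= 2 * t * nr (P N) + 4 * t ^+ N * (M * nr v).
    rewrite -(anormZ an) e2.
    have h1 := anormB ((2%:R * r) *: P N + a1) a2.
    have h2 := anormD an ((2%:R * r) *: P N) a1.
    have h3 : nr ((2%:R * r) *: P N) = 2 * t * nr (P N) by rewrite (anormZ an) modcM m2.
    lra.
  have t1 : 0 <= 1 - t by lra.
  have := ler_wpM2r t1 n3.
  have q1 := nP N.
  have q2 : 0 <= 2 * M * t ^+ N.+1 by apply: mulr_ge0 (exprn_ge0 _ t0); lra.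
  have q3 : 2 * t * ((1 - t) * nr (P N)) <= 2 * t * (M * (1 + t)).
    by apply: ler_wpM2l; lra.
  have q4 : 0 <= t ^+ N * (M * nr v) * t by apply: mulr_ge0 t0; apply: mulr_ge0.
  lra.
have {}key := le_geom t0 r1 key.
have tgt0 : 0 < t.
  rewrite lt_def t0 andbT; apply/eqP => te; move: rz.
  have : t ^+ 2 = 0 by rewrite te expr0n.
  rewrite sqr_modc; case: (r) => a b /= ab.
  have [-> ->] : a = 0 /\ b = 0 by split; nra.
  by rewrite mulr0 expr0n add0r => /eqP; rewrite oner_eq0.
(* This is the imaginary part of 2z = r + 1/r. *)
have A1 : 2 * t ^+ 2 * `|complex.Im z| = `|complex.Im r| * (1 - t ^+ 2).
  have t2 : 0 <= 1 - t ^+ 2 by nra.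
  have h0 : 0 <= 2 * t ^+ 2 by rewrite mulr_ge0 ?sqr_ge0.
  rewrite -{1}(ger0_norm h0) -{1}(ger0_norm t2) -!normrM -[RHS]normrN; congr `|_|.
  move: rz; rewrite /t sqr_modc; case: (r) (z) => a b [p q] /=; rewrite !expr2.
  move=> [e1 e2].
  have := congr1 ( *%R a) e2; have := congr1 ( *%R b) e1. lra.
(* The modulus of 1/r - r is at least that of its imaginary part, which is |Im r|(1 + 1/t^2). *)
have A2 : `|complex.Im r| * (1 + t ^+ 2) <= t * modc (1 - r ^+ 2).
  rewrite -(@ler_pXn2r _ 2) ?nnegrE ?mulr_ge0 ?modc_ge0 ?addr_ge0 ?sqr_ge0 //.
  rewrite !exprMn sqr_modc real_normK ?num_real // /t sqr_modc.
  case: (r) => a b /=; rewrite !expr2 /=.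
  rewrite -subr_ge0 (_ : _ - _ = (a * (1 - (a * a + b * b))) ^+ 2) ?sqr_ge0 //.
  by ring.
set n := nr v in key v0 *; set d := modc _ in key A2; set Y := `|complex.Im z| in A1 *.
set J := `|complex.Im r| in A1 A2.
have J0 : 0 <= J by rewrite normr_ge0.
have Y0 : 0 <= Y by rewrite normr_ge0.
have s1 : n * Y * (2 * t ^+ 2) * (1 - t) * (1 + t ^+ 2) <= 2 * t ^+ 2 * (1 - t ^+ 2) * (M * (1 + t)).
  have -> : n * Y * (2 * t ^+ 2) * (1 - t) * (1 + t ^+ 2) =
     (2 * t ^+ 2 * Y) * (n * (1 - t) * (1 + t ^+ 2)) by ring.
  rewrite A1.
  have w0 : 0 <= n * (1 - t) * (1 - t ^+ 2) by rewrite !mulr_ge0 //; nra.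
  have w1 := ler_wpM2r w0 A2.
  have w2 : 0 <= t * (1 - t ^+ 2) by rewrite mulr_ge0 //; nra.
  have w3 := ler_wpM2r w2 key.
  lra.
have D0 : 0 < 2 * t ^+ 2 * (1 - t) by rewrite !mulr_gt0 ?exprn_gt0 //; lra.
have s2 : n * Y * (1 + t ^+ 2) <= (1 + t) ^+ 2 * M.
  rewrite -(ler_pM2l D0); lra.
have s3 : (1 + t) ^+ 2 * M <= 2 * M * (1 + t ^+ 2).
  have M0 : 0 <= M by lra.
  by have := mulr_ge0 M0 (sqr_ge0 (1 - t)); lra.
have p0 : 0 < 1 + t ^+ 2 by rewrite addr_gt0 ?exprn_gt0.
by rewrite -(ler_pM2r p0); lra.
Qed.

End NormedAlgebra.

(** * Resolvent identity and averages over roots of unity *)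

Section Resolvent.
Variables (R : realType) (T : algType R[i]) (nr : T -> R).
Variable an : algebra_norm nr.
Implicit Types (x y q u v e : T) (z w : R[i]).

Lemma resolvent_identity x z w u v :
  u * (z%:A - x) = 1 -> (w%:A - x) * v = 1 -> u - v = (w - z) *: (u * v).
Proof.
move=> uz wv.
have e1 : u = u * ((w%:A - x) * v) by rewrite wv mulr1.
have e2 : v = u * (z%:A - x) * v by rewrite uz mul1r.
rewrite {1}e1 {2}e2 -mulrA -mulrBr -mulrBl opprB addrA subrK -scalerBl.
by rewrite -scalerAl mul1r scalerAr.
Qed.

(** By the resolvent identity u = v + (w - z)uv, whence |u| <= |v| + |u|/2. *)
Lemma resolvent_near x z w u v :
  u * (z%:A - x) = 1 -> (w%:A - x) * v = 1 ->
  modc (z - w) * nr v <= 2^-1 -> nr u <= 2 * nr v.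
Proof.
move=> uz wv zw.
have e1 : u = v + (w - z) *: (u * v).
  by rewrite -(resolvent_identity uz wv) addrC subrK.
have n1 := anormD an v ((w - z) *: (u * v)).
rewrite -e1 (anormZ an) -modcN opprB in n1.
have n2 : modc (z - w) * nr (u * v) <= nr u * 2^-1.
  apply: le_trans (ler_wpM2l (modc_ge0 _) (anormM an _ _)) _.
  by rewrite mulrCA; apply: ler_wpM2l => //; apply: anorm_ge0.
lra.
Qed.

Lemma sum_prim_root (N m : nat) w : N.-primitive_root w ->
  \sum_(j < N) w ^+ (j * m) = if (N %| m)%N then N%:R else 0.
Proof.
move=> wN.
rewrite (eq_bigr (fun j : 'I_N => (w ^+ m) ^+ j)); last first.
  by move=> j _; rewrite mulnC exprM.
rewrite (prim_order_dvd wN); case: eqP => [->|/eqP wm].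
  rewrite (eq_bigr (fun=> 1)) => [|j _]; last by rewrite expr1n.
  by rewrite sumr_const card_ord.
have : (w ^+ m - 1) * \sum_(j < N) (w ^+ m) ^+ j = 0.
  by rewrite -subrX1 exprAC (prim_expr_order wN) expr1n subrr.
by move=> /eqP; rewrite mulf_eq0 subr_eq0 (negPf wm) /= => /eqP.
Qed.

(* Discrete form of the Cauchy integral of z^l (z - y)^-1 over the unit circle. *)
Lemma sum_resolvent_roots (N l : nat) w y (V : nat -> T) :
  N.-primitive_root w -> (l < N)%N ->
  (forall j, V j * ((w ^+ j)%:A - y) = 1) ->
  (\sum_(j < N) w ^+ (j * l.+1) *: V j) * (1 - y ^+ N) = N%:R *: y ^+ l.
Proof.
move=> wN lN Vj.
(* Since w^(jN) = 1, the factor 1 - y^N is (w^j)^N - y^N, which w^j - y divides; [V j] cancels that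
   divisor. *)
have E j : w ^+ (j * l.+1) *: V j * (1 - y ^+ N) =
    \sum_(i < N) w ^+ (j * (l.+1 + (N.-1 - i))) *: y ^+ i.
  have wjN : ((w ^+ j)%:A : T) ^+ N = 1.
    by rewrite exprZn expr1n exprAC (prim_expr_order wN) expr1n scale1r.
  rewrite -wjN subrXX_comm; last by rewrite /GRing.comm -scalerAl -scalerAr mul1r mulr1.
  rewrite -scalerAl mulrA Vj mul1r scaler_sumr; apply: eq_bigr => i _.
  by rewrite exprZn expr1n -scalerAl mul1r scalerA -exprM -exprD -mulnDr.
rewrite mulr_suml (eq_bigr _ (fun (j : 'I_N) _ => E j)) exchange_big /=.
rewrite (eq_bigr (fun i : 'I_N => (if i == Ordinal lN then N%:R else 0) *: y ^+ i)); last first.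
  move=> i _; rewrite -scaler_suml sum_prim_root //; congr (_ *: _).
  have iN := ltn_ord i.
  (* The exponent lies between 1 and 2N - 1, so N divides it only if it equals N, that is i = l. *)
  suff -> : (N %| l.+1 + (N.-1 - i))%N = (i == Ordinal lN) by [].
  apply/idP/eqP => [/dvdnP[k hk]|->].
    apply: val_inj => /=; case: k hk => [|[|k]] hk; first by lia.
      by lia.
    by move: hk; rewrite !mulSn; lia.
  by rewrite /= (_ : l.+1 + (N.-1 - l) = N)%N //; lia.
rewrite (bigD1 (Ordinal lN)) //= eqxx big1 ?addr0 // => i /negPf ->.
by rewrite scale0r.
Qed.

End Resolvent.

(** * Vanishing of [q], whose resolvent [V] exists off the purely imaginary point [lam] *)

Section Quasinilpotent.
Variables (R : realType) (T : algType R[i]) (nr : T -> R).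
Variable an : algebra_norm nr.
Variables (q : T) (lam : R[i]) (V : R[i] -> T) (M : R).
Hypothesis lam_im : complex.Re lam = 0.
Hypothesis VL : forall z, z != lam -> V z * (z%:A - q) = 1.
Hypothesis VR : forall z, z != lam -> (z%:A - q) * V z = 1.
Hypothesis VM : forall z, z != lam -> complex.Im z != 0 ->
  nr (V z) * `|complex.Im z| <= 2 * M.
Implicit Types (u v e y : T) (z w : R[i]).

(** Away from the real axis [VM] bounds [V], even close to [lam]. Near the axis, z is close to p or
    -p, which differ from the purely imaginary [lam], and [resolvent_near] applies. *)
Lemma resolvent_near_circle (p : R) : 0 < p ->
  exists K d : R, [/\ 0 <= K, 0 < d & forall z, z != lam ->
    `|modc z - p| <= d -> nr (V z) <= K].
Proof.
move=> p0.
have real_neq (r : R) : r != 0 -> r%:C != lam.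
  by apply: contra_neq => /(congr1 (@complex.Re _)) /= ->.
have p1 : p%:C != lam by rewrite real_neq ?gt_eqF.
have p2 : (- p)%:C != lam by rewrite real_neq ?oppr_eq0 ?gt_eqF.
pose n := nr (V p%:C) + nr (V (- p)%:C) + 1.
have h1 : 0 <= nr (V p%:C) := anorm_ge0 an _.
have h2 : 0 <= nr (V (- p)%:C) := anorm_ge0 an _.
have n0 : 0 < n by rewrite /n; lra.
(* If |Im z| <= d/2 and |z| is within d of p, then z is within 2d of p or -p; here 2dn = 1/2, the
   threshold in [resolvent_near]. *)
pose d := (4 * n)^-1.
have d0 : 0 < d by rewrite invr_gt0; lra.
have dn : d * n = 4^-1.
  by rewrite /d invfM -mulrA mulVf ?gt_eqF // mulr1.
exists (2 * n + 2 * `|M| / (d / 2)), d; split=> //.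
  by rewrite addr_ge0 ?mulr_ge0 ?invr_ge0 //; lra.
move=> z zl zp.
have K2 : 0 <= 2 * `|M| / (d / 2) by rewrite mulr_ge0 ?mulr_ge0 ?invr_ge0 //; lra.
have [zi|zi] := lerP `|complex.Im z| (d / 2); last first.
  have zi0 : complex.Im z != 0 by rewrite -normr_gt0; lra.
  have h := VM zl zi0.
  have d2 : 0 < d / 2 by lra.
  have : nr (V z) <= 2 * `|M| / (d / 2).
    rewrite ler_pdivlMr //; have := ler_norm M.
    have := ler_wpM2l (anorm_ge0 an (V z)) (ltW zi); lra.
  lra.
have near (s : R) : s = 1 \/ s = -1 -> 0 <= s * complex.Re z ->
    nr (V (s * p)%:C) <= n -> nr (V z) <= 2 * n.
  move=> s1 sz sn.
  have sl : (s * p)%:C != lam by case: s1 => ->; rewrite ?mul1r ?mulN1r.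
  have zs : modc (z - (s * p)%:C) <= 2 * d.
    have -> : z - (s * p)%:C = (z - (s * modc z)%:C) + (s * (modc z - p))%:C.
      by rewrite mulrBr rmorphB /= addrA subrK.
    apply: le_trans (modcD _ _) _.
    have := dist_real_modulus s1 sz.
    have -> : modc (s * (modc z - p))%:C = `|modc z - p|.
      by rewrite modc_real normrM; case: s1 => ->; rewrite ?normrN normr1 mul1r.
    lra.
  have := resolvent_near an (VL zl) (VR sl).
  have : modc (z - (s * p)%:C) * nr (V (s * p)%:C) <= 2 * d * n.
    by apply: ler_pM => //; rewrite ?modc_ge0 ?(anorm_ge0 an).
  move=> h /(_ ltac:(lra)); lra.
have [rz|rz] := lerP 0 (complex.Re z).
  have := near 1 (or_introl erefl); rewrite !mul1r => /(_ rz).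
  rewrite /n; move=> /(_ ltac:(lra)); lra.
have := near (-1) (or_intror erefl); rewrite !mulN1r oppr_ge0 => /(_ (ltW rz)).
rewrite /n; move=> /(_ ltac:(lra)); lra.
Qed.

Lemma scaled_resolvent (r : R) w : r != 0 -> modc w = 1 -> `|r| != modc lam ->
  (r%:C *: V (r%:C * w)) * (w%:A - r^-1%:C *: q) = 1.
Proof.
move=> r0 w1 rl.
have zl : r%:C * w != lam.
  by apply: contra_neq rl => <-; rewrite modcM modc_real w1 mulr1.
rewrite -[RHS](VL zl) -scalerAl scalerAr; congr (_ * _).
by rewrite scalerBr !scalerA -(rmorphM (real_complex R)) mulfV // rmorph1 scale1r.
Qed.

Lemma prim_root_modc (N j : nat) w : N.-primitive_root w -> modc (w ^+ j) = 1.
Proof.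
move=> wN; have N0 := prim_order_gt0 wN.
apply/eqP; rewrite -(@pexpr_eq1 _ _ N) ?modc_ge0 // -modcX exprAC.
by rewrite (prim_expr_order wN) expr1n modc1.
Qed.

(** Discrete form of 1/(2 pi i) times the contour integral of the resolvent over |z| = r; the factor
    z comes from dz = i z d(theta). *)
Definition circle_mean (N : nat) w (r : R) : T :=
  N%:R^-1 *: \sum_(j < N) (r%:C * w ^+ j) *: V (r%:C * w ^+ j).

Lemma circle_mean_inv (N : nat) w (r : R) : N.-primitive_root w ->
  0 < r -> r != modc lam ->
  circle_mean N w r * (1 - (r^-1%:C *: q) ^+ N) = 1.
Proof.
move=> wN r0 rl; have N0 := prim_order_gt0 wN.
pose W j := r%:C *: V (r%:C * w ^+ j).
have hW j : W j * ((w ^+ j)%:A - r^-1%:C *: q) = 1.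
  apply: scaled_resolvent; first by rewrite gt_eqF.
    exact: (prim_root_modc j wN).
  by rewrite gtr0_norm.
have := sum_resolvent_roots wN N0 hW.
rewrite expr0 /circle_mean -scalerAl => h.
rewrite (eq_bigr (fun j : 'I_N => w ^+ (j * 1) *: W j)); last first.
  by move=> j _; rewrite muln1 /W scalerA mulrC.
by rewrite h scalerA mulVf ?scale1r // pnatr_eq0 -lt0n.
Qed.

(** As z V(z) = 1 + q V(z), two corresponding terms differ by q(V(z) - V(z')), which the resolvent
    identity bounds by |r - s| |q| K^2. Averaging keeps the bound, so it is uniform in N. *)
Lemma circle_mean_lip (N : nat) w (r s p K d : R) : N.-primitive_root w ->
  0 < r -> 0 < s -> r != modc lam -> s != modc lam ->
  0 <= K -> `|r - p| <= d -> `|s - p| <= d ->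
  (forall z, z != lam -> `|modc z - p| <= d -> nr (V z) <= K) ->
  nr (circle_mean N w r - circle_mean N w s) <= `|r - s| * (nr q * K ^+ 2).
Proof.
move=> wN r0 s0 rl sl K0 rp sp VK; have N0 := prim_order_gt0 wN.
have q0 := anorm_ge0 an q.
have Nn0 : (N%:R : R[i]) != 0 by rewrite pnatr_eq0 -lt0n.
rewrite /circle_mean -scalerBr -sumrB (anormZ an).
set D := `|r - s| * _.
have term (j : 'I_N) : nr ((r%:C * w ^+ j) *: V (r%:C * w ^+ j) -
    (s%:C * w ^+ j) *: V (s%:C * w ^+ j)) <= D.
  have w1 := prim_root_modc j wN.
  have mz (t : R) : 0 < t -> modc (t%:C * w ^+ j) = t.
    by move=> t0; rewrite modcM w1 mulr1 modc_real gtr0_norm.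
  have nl (t : R) : 0 < t -> t != modc lam -> t%:C * w ^+ j != lam.
    by move=> t0; apply: contra_neq => <-; rewrite mz.
  have zV z : z != lam -> z *: V z = 1 + q * V z.
    by move=> zl; rewrite -(VR zl) mulrBl -scalerAl mul1r subrK.
  have zr := nl r r0 rl; have zs := nl s s0 sl.
  rewrite !zV // opprD addrACA subrr add0r -mulrBr.
  rewrite (resolvent_identity (VL zr) (VR zs)).
  have n1 : nr (V (r%:C * w ^+ j)) <= K by apply: VK; rewrite ?mz.
  have n2 : nr (V (s%:C * w ^+ j)) <= K by apply: VK; rewrite ?mz.
  rewrite -mulrBl -rmorphB -scalerAr (anormZ an) modcM w1 mulr1 modc_real distrC.
  rewrite /D; apply: ler_wpM2l; first exact: normr_ge0.
  apply: le_trans (anormM an _ _) _; apply: ler_wpM2l => //.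
  apply: le_trans (anormM an _ _) _.
  by rewrite expr2; apply: ler_pM; rewrite ?(anorm_ge0 an).
have := anorm_sum an term.
rewrite sumr_const card_ord => h.
have -> : modc (N%:R : R[i])^-1 = (N%:R : R)^-1.
  rewrite -(rmorph_nat (real_complex R)) -fmorphV modc_real ger0_norm //.
  by rewrite invr_ge0.
by rewrite mulrC ler_pdivrMr ?ltr0n // mulr_natr.
Qed.

(* Division-free form of: the spectral radius of q is less than r. *)
Definition small_power (r : R) : Prop :=
  exists2 N : nat, (0 < N)%N & nr (q ^+ N) <= r ^+ N / 8.

Lemma small_power_le (r s : R) : 0 <= r -> r <= s -> small_power r -> small_power s.
Proof.
move=> r0 rs [N N0 h]; exists N => //; apply: le_trans h _.
apply: ler_wpM2r; first by rewrite invr_ge0.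
by apply: lerXn2r; rewrite ?nnegrE // (le_trans r0).
Qed.

Lemma norm_scaled_power (r : R) (N : nat) : 0 < r ->
  nr ((r^-1%:C *: q) ^+ N) = nr (q ^+ N) / r ^+ N.
Proof.
move=> r0; rewrite exprZn (anormZ an) -rmorphXn modc_real ger0_norm.
  by rewrite exprVn mulrC.
by rewrite exprn_ge0 // invr_ge0 ltW.
Qed.

(* Rickart's argument: circle_mean is Lipschitz in the radius uniformly in N, and
   it is the inverse of 1 - (q/r)^N. *)
Lemma small_power_descent (r s p K d : R) :
  0 < r -> 0 < s -> r != modc lam -> s != modc lam ->
  0 <= K -> `|r - p| <= d -> `|s - p| <= d ->
  (forall z, z != lam -> `|modc z - p| <= d -> nr (V z) <= K) ->
  `|r - s| * (nr q * K ^+ 2) <= 100^-1 ->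
  small_power s -> small_power r.
Proof.
move=> r0 s0 rl sl K0 rp sp VK rsK [N N0 hN].
have [w wN] := closed_field_prim_root (natc_neq0 R N0).
have lip := le_trans (circle_mean_lip wN r0 s0 rl sl K0 rp sp VK) rsK.
have er := circle_mean_inv wN r0 rl; have es := circle_mean_inv wN s0 sl.
set a := circle_mean N w r in lip er; set b := circle_mean N w s in lip es.
set u := _ ^+ N in er; set v := _ ^+ N in es.
have v8 : nr v <= 8^-1.
  by rewrite norm_scaled_power // ler_pdivrMr ?exprn_gt0 // mulrC.
(* From b = 1 + bv and |v| <= 1/8 follows |b - 1| <= 1/7, so |a - 1| <= 1/7 + 1/100 < 1/6; then u =
   (a - 1)(1 - u) gives |u| <= 1/5. *)
have b1 : b - 1 = b * v.
  by rewrite -[X in _ - X]es mulrBr mulr1 opprB addrC subrK.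
have u1 : u = (a - 1) * (1 - u).
  by rewrite mulrBl er mul1r opprB addrC subrK.
have n1 : nr (b - 1) <= nr b * nr v by rewrite b1 (anormM an).
have n2 := anormD an (b - 1) 1; rewrite subrK (anorm1 an) in n2.
have b0 := anorm_ge0 an b.
have n3 : nr b * nr v <= nr b * 8^-1 by apply: ler_wpM2l.
have n4 : nr (a - 1) <= 6^-1.
  have := anormD an (a - b) (b - 1); rewrite addrA subrK; lra.
have n5 : nr u <= nr (a - 1) * nr (1 - u) by rewrite {1}u1 (anormM an).
have n6 := anormB an 1 u; rewrite (anorm1 an) in n6.
have n7 : nr (a - 1) * nr (1 - u) <= 6^-1 * nr (1 - u).
  by apply: ler_wpM2r => //; apply: anorm_ge0.
have n8 : nr u <= 5^-1 by lra.
(* Squaring restores the constant: 1/25 <= 1/8. *)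
exists (N * 2)%N; first by rewrite muln_gt0 N0.
rewrite mulrC -ler_pdivrMr ?exprn_gt0 // -norm_scaled_power // exprM -/u.
rewrite expr2; apply: le_trans (anormM an _ _) _.
have : nr u * nr u <= 5^-1 * 5^-1 by apply: ler_pM; rewrite ?(anorm_ge0 an).
lra.
Qed.

(** Serves to choose radii other than |lam|, so that the circles miss [lam]. *)
Lemma exists_neq (a b m : R) : a < b -> exists2 s : R, a < s < b & s != m.
Proof.
move=> ab; have [e|e] := eqVneq ((a + b) / 2) m; last first.
  by exists ((a + b) / 2) => //; lra.
by exists ((3 * a + b) / 4); [lra | apply/eqP; lra].
Qed.

(** Otherwise the infimum p of the good radii is positive. The resolvent is bounded near the circle
    of radius p, so a good radius just above p yields one just below p. *)
Lemma small_power_all (r : R) : 0 < r -> small_power r.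
Proof.
move=> r0; apply: contrapT => nr_small.
pose E : set R := [set s | 0 < s /\ small_power s].
have lbr : lbound E r.
  move=> s [s0 ss]; rewrite leNgt; apply/negP => sr.
  by apply: nr_small; apply: small_power_le ss; rewrite ltW.
have q0 := anorm_ge0 an q.
have Eq : E (8 * (nr q + 1)).
  split; first by lra.
  by exists 1%N => //; rewrite !expr1; lra.
have Einf : has_inf E by split; [exists (8 * (nr q + 1)) | exists r].
set p := inf E.
have rp : r <= p by apply: lb_le_inf => //; exists (8 * (nr q + 1)).
have p0 : 0 < p by lra.
have [K [d [K0 d0 VK]]] := resolvent_near_circle p0.
pose L := nr q * K ^+ 2 + 1.
have L0 : 0 < L by rewrite /L ltr_wpDl ?mulr_ge0 ?exprn_ge0.
(* The three bounds keep both radii within d of p, keep t positive, and give |t - s| L <= 2hL <=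
   1/100. *)
pose h := Num.min (Num.min d (p / 2)) (200 * L)^-1.
have h0 : 0 < h by rewrite !lt_min d0 invr_gt0 !divr_gt0 //=; lra.
have hd : h <= d by rewrite /h !ge_min lexx.
have hp : h <= p / 2 by rewrite /h !ge_min lexx !orbT.
have hL : h * L <= 200^-1.
  rewrite -ler_pdivlMr // -invfM.
  by rewrite /h ge_min lexx orbT.
have [s' Es' s'p] := inf_adherent h0 Einf.
have [s /andP[s1 s2] sl] := exists_neq (modc lam) s'p.
have ps' : p <= s' by apply: ge_inf => //; exists r.
have [t /andP[t1 t2] tl] : exists2 t, p - h < t < p & t != modc lam.
  by apply: exists_neq; lra.
have ss : small_power s by apply: small_power_le (proj2 Es'); lra.
suff tE : E t by have := @ge_inf _ E (ex_intro _ r lbr) t tE; rewrite -/p; lra.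
split; first by lra.
apply: (@small_power_descent t s p K d) => //; try lra.
- by rewrite ler_norml; lra.
- by rewrite ler_norml; rewrite -/p in s2; lra.
have : `|t - s| <= 2 * h by rewrite ler_norml; rewrite -/p in s2; lra.
move=> ts; rewrite -/p in s2.
have KL : nr q * K ^+ 2 <= L by rewrite /L; lra.
have := ler_wpM2l (normr_ge0 (t - s)) KL.
have := ler_wpM2r (ltW L0) ts; lra.
Qed.

(* The weight w^2 - 1 has modulus 2 |Im w| on the unit circle, which cancels the
   blow-up of the resolvent at the real axis. *)
Lemma quasinilpotent_bound (r : R) : 0 <= M -> 0 < r -> r != modc lam ->
  nr q <= r * (2 + 8 * M).
Proof.
move=> M0 r0 rl.
have [N0 N00 hN0] := small_power_all r0.
set y := r^-1%:C *: q.
have y0 := anorm_ge0 an y.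
have yN0 : nr (y ^+ N0) <= 8^-1.
  by rewrite norm_scaled_power // ler_pdivrMr ?exprn_gt0 // mulrC.
(* This threshold makes both |y^m| and M |y^m| at most 1/8. *)
have e0 : 0 < (8 * (M + 1))^-1 by rewrite invr_gt0; lra.
have [k] : exists k, 1 * 8^-1 ^+ k < (8 * (M + 1))^-1.
  by apply: geom_small => //; lra.
rewrite mul1r => hk.
pose m := (N0 * k.+1)%N.
have ym : nr (y ^+ m) <= (8 * (M + 1))^-1.
  rewrite exprM; apply: le_trans (anormX an _ _) _.
  apply: (@le_trans _ _ (8^-1 ^+ k.+1)).
    by apply: lerXn2r; rewrite ?nnegrE ?(anorm_ge0 an) ?invr_ge0.
  apply: le_trans (ltW hk); rewrite exprS ler_piMl ?exprn_ge0 //; lra.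
have m0 : (0 < m)%N by rewrite muln_gt0 N00.
have [w wN] := closed_field_prim_root (natc_neq0 R (ltn0Sn m)).
pose W j := r%:C *: V (r%:C * w ^+ j).
have hW j : W j * ((w ^+ j)%:A - y) = 1.
  apply: scaled_resolvent; first by rewrite gt_eqF.
    exact: (prim_root_modc j wN).
  by rewrite gtr0_norm.
(* With m + 1 roots, l = 1 carries the weight w^(2j) and yields y, while l = m carries w^(j(m+1)) =
   1 and yields the small term y^m; the difference has weight w^(2j) - 1. *)
have S1 := sum_resolvent_roots wN (m0 : (1 < m.+1)%N) hW.
have S2 := sum_resolvent_roots wN (ltnSn m) hW.
have term (j : 'I_m.+1) : nr (w ^+ (j * 2) *: W j - w ^+ (j * m.+1) *: W j) <= 4 * M.
  have w1 := prim_root_modc j wN.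
  have -> : w ^+ (j * m.+1) = 1 by rewrite mulnC exprM (prim_expr_order wN) expr1n.
  rewrite -scalerBl (anormZ an) exprM modc_sqrB1 // (anormZ an) modc_real (gtr0_norm r0).
  set z := r%:C * w ^+ j.
  have zi : complex.Im z = r * complex.Im (w ^+ j).
    by rewrite /z; case: (w ^+ j) => a b /=; rewrite mul0r addr0.
  have [wi|wi] := eqVneq (complex.Im (w ^+ j)) 0.
    by rewrite wi normr0 mulr0 mul0r mulr_ge0.
  have zi0 : complex.Im z != 0 by rewrite zi mulf_eq0 negb_or wi gt_eqF.
  have zl : z != lam.
    by apply: contra_neq rl => <-; rewrite modcM modc_real w1 mulr1 gtr0_norm.
  have := VM zl zi0; rewrite zi normrM (gtr0_norm r0); lra.
have := anorm_sum an term; rewrite sumr_const card_ord sumrB.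
set A := \sum_(j < _) _ in S1 *; set B := \sum_(j < _) _ in S2 * => AB.
have E : (A - B) * (1 - y ^+ m.+1) = m.+1%:R *: (y - y ^+ m).
  by rewrite mulrBl S1 S2 expr1 scalerBr.
have m1 : modc (m.+1%:R : R[i]) = m.+1%:R.
  by rewrite -(rmorph_nat (real_complex R)) modc_real ger0_norm.
have n1 : m.+1%:R * nr (y - y ^+ m) <= (4 * M *+ m.+1) * (1 + nr (y ^+ m.+1)).
  rewrite -m1 -(anormZ an) -E; apply: le_trans (anormM an _ _) _.
  apply: ler_pM; rewrite ?(anorm_ge0 an) //.
  by rewrite -(anorm1 an); apply: anormB.
rewrite -(mulr_natl (4 * M)) -(mulrA m.+1%:R) ler_pM2l ?ltr0n // in n1.
have n2 : nr (y ^+ m.+1) <= nr y * nr (y ^+ m) by rewrite exprS (anormM an).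
have n3 : nr y <= nr (y - y ^+ m) + nr (y ^+ m).
  by rewrite -{1}(subrK (y ^+ m) y) (anormD an).
have eM : (M + 1) * (8 * (M + 1))^-1 = 8^-1.
  by rewrite invfM mulrCA mulfV ?mulr1 //; apply/eqP; lra.
have n4 : M * nr (y ^+ m) <= 8^-1.
  rewrite -eM; apply: ler_pM; rewrite ?(anorm_ge0 an) //; lra.
have n5 : nr (y ^+ m) <= 8^-1.
  apply: le_trans ym _; rewrite -eM; apply: ler_peMl; [exact: ltW | lra].
have n6 : M * nr (y ^+ m.+1) <= nr y * 8^-1.
  apply: le_trans (ler_wpM2l M0 n2) _; rewrite mulrCA; exact: ler_wpM2l.
(* Altogether |y| <= 4M + |y|/2 + 1/8. *)
have n7 : nr y <= 2 + 8 * M by lra.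
have -> : nr q = r * nr y.
  rewrite (anormZ an) modc_real ger0_norm ?invr_ge0 ?ltW //.
  by rewrite mulrA mulfV ?mul1r // gt_eqF.
by rewrite ler_pM2l.
Qed.

Lemma quasinilpotent_eq0 : 0 <= M -> q = 0.
Proof.
move=> M0; apply: (anorm0_eq0 an); apply: contrapT => /eqP q1.
have q0 : 0 < nr q by rewrite lt_def q1 (anorm_ge0 an).
pose C := 2 + 8 * M.
have C0 : 0 < C by rewrite /C; lra.
have [r /andP[r0 r1] rl] := exists_neq (modc lam) (divr_gt0 q0 C0).
have := quasinilpotent_bound M0 r0 rl.
rewrite ltr_pdivlMr // in r1; rewrite -/C; lra.
Qed.

End Quasinilpotent.

(** * The scalar case and the reduction to it *)

(** The recursion is Chebyshev's. For |a| <= 1 it is solved by cos(n acos a); for |a| > 1 the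
    increments of |c_n| are at least |a| - 1, against boundedness. *)
Lemma bounded_cosine_scalar (R : realType) (T : algType R[i]) (nr : T -> R)
    (c : nat -> T) (a M : R) : algebra_norm nr ->
  c 0%N = 1 -> c 1%N = (a%:C)%:A ->
  (forall n, c n.+2 + c n = 2%:R *: (c n.+1 * c 1%N)) ->
  (forall n, nr (c n) <= M) ->
  exists b : R, forall n, c n = ((cos (n%:R * b))%:C)%:A.
Proof.
move=> an c0 c1 crec cM.
have rec2 n : c n.+2 = (2 * a)%:C *: c n.+1 - c n.
  rewrite -[LHS](addrK (c n)) crec c1 -scalerAr mulr1 scalerA; congr (_ *: _ - _).
  by rewrite rmorphM rmorph_nat.
have [a1|a1] := lerP `|a| 1.
  have aK : cos (acos a) = a by rewrite acosK // in_itv /= -ler_norml.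
  exists (acos a) => n; set b := acos a.
  suff [] : c n = ((cos (n%:R * b))%:C)%:A /\ c n.+1 = ((cos (n.+1%:R * b))%:C)%:A by [].
  elim: n => [|n [IH1 IH2]].
    by rewrite mul0r cos0 c0 rmorph1 scale1r mul1r aK c1.
  split=> //; rewrite rec2 IH1 IH2 scalerA -scalerBl -rmorphM -rmorphB; congr (_%:C *: _).
  have -> : n.+2%:R * b = n.+1%:R * b + b by rewrite -[n.+2]addn1 natrD mulrDl mul1r.
  have -> : n%:R * b = n.+1%:R * b - b by rewrite -[n.+1]addn1 natrD mulrDl mul1r addrK.
  rewrite cosB cosD aK; ring.
have nr1 : nr (c 1%N) = `|a| by rewrite c1 (anormZ an) (anorm1 an) mulr1 modc_real.
have grow n : nr (c n) + (`|a| - 1) <= nr (c n.+1).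
  elim: n => [|n IH]; first by rewrite nr1 c0 (anorm1 an); lra.
  have h : 2 * `|a| * nr (c n.+1) <= nr (c n.+2) + nr (c n).
    have -> : 2 * `|a| * nr (c n.+1) = nr ((2 * a)%:C *: c n.+1).
      by rewrite (anormZ an) modc_real normrM ger0_norm.
    by rewrite -[_ *: c n.+1](subrK (c n)) -rec2 (anormD an).
  have c0' := anorm_ge0 an (c n.+1).
  have : 0 <= (`|a| - 1) * nr (c n.+1) by apply: mulr_ge0 => //; lra.
  lra.
have lin n : n%:R * (`|a| - 1) <= nr (c n).
  elim: n => [|n IH]; first by rewrite mul0r anorm_ge0.
  by rewrite -[n.+1]addn1 natrD mulrDl mul1r addn1; have := grow n; lra.
have M0 : 0 <= M := le_trans (anorm_ge0 an _) (cM 0%N).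
have d0 : 0 < `|a| - 1 by lra.
have := archi_boundP (divr_ge0 M0 (ltW d0)); rewrite ltr_pdivrMr //.
by have := lin (Num.bound (M / (`|a| - 1))); have := cM (Num.bound (M / (`|a| - 1))); lra.
Qed.

(** Subtracting Re lam from c_1 makes the exceptional point purely imaginary; a real shift of z
    preserves Im z, so the Poisson bound carries over to [q]. *)
Lemma bounded_cosine_algebra (R : realType) (T : algType R[i]) (nr : T -> R)
    (c : nat -> T) (lam : R[i]) (M : R) : algebra_norm nr ->
  c 0%N = 1 ->
  (forall n, c n.+2 + c n = 2%:R *: (c n.+1 * c 1%N)) ->
  (forall n, nr (c n) <= M) ->
  (forall z, z != lam -> exists y, (z%:A - c 1%N) * y = 1 /\ y * (z%:A - c 1%N) = 1) ->
  exists b : R, forall n, c n = ((cos (n%:R * b))%:C)%:A.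
Proof.
move=> an c0 crec cM spec.
set a := complex.Re lam; set q := c 1%N - (a%:C)%:A.
have qE z : z%:A - q = (z + a%:C)%:A - c 1%N.
  by rewrite /q opprB scalerDl addrA.
have /choice[V hV] : forall z, exists y, z != lam - a%:C ->
    (z%:A - q) * y = 1 /\ y * (z%:A - q) = 1.
  (* At the exceptional point [V] takes the arbitrary value 0. *)
  move=> z; have [zl|zl] := eqVneq z (lam - a%:C); first by exists 0.
  have [|y hy] := spec (z + a%:C); last by exists y; rewrite qE.
  by apply: contra_neq zl => <-; rewrite addrK.
suff q0 : q = 0.
  by apply: (bounded_cosine_scalar (a := a) an c0 _ crec cM); apply/eqP; rewrite -subr_eq0 -/q q0.
have M0 : 0 <= M := le_trans (anorm_ge0 an _) (cM 0%N).
apply: (@quasinilpotent_eq0 _ _ _ an q (lam - a%:C) V M) => //.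
- by rewrite raddfB /= subrr.
- by move=> z /hV[].
- by move=> z /hV[].
move=> z /hV[zV _] zi; rewrite qE in zV.
have e : complex.Im (z + a%:C) = complex.Im z by rewrite raddfD /= addr0.
by rewrite -e; apply: (resolvent_bound an c0 erefl crec cM) zV; rewrite e.
Qed.

(* Copy of A on which mul is registered as a ring multiplication. *)
Definition uba_alg {R : realType} {A : completeNormedModType R[i]}
  {mul : A -> A -> A} {one : A} (H : unital_banach_algebra mul one) : Type := A.

(** * Transport to the given Banach algebra and conclusion *)

Section UbaAlg.
Variables (R : realType) (A : completeNormedModType R[i]).
Variables (mul : A -> A -> A) (one : A) (H : unital_banach_algebra mul one).

Lemma uba_one_neq0 : one != 0.
Proof.
apply/eqP => e; have := uba_norm1 H.
by rewrite e normr0 => /eqP; rewrite eq_sym oner_eq0.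
Qed.

HB.instance Definition _ := GRing.Lmodule.copy (uba_alg H) A.
HB.instance Definition _ := GRing.Zmodule_isNzRing.Build (uba_alg H)
  (uba_mulA H) (uba_mul1l H) (uba_mul1r H) (uba_mulDl H) (uba_mulDr H) uba_one_neq0.
HB.instance Definition _ := GRing.Lmodule_isLalgebra.Build R[i] (uba_alg H)
  (fun k x y => esym (uba_mulZl H k x y)).
HB.instance Definition _ := GRing.Lalgebra_isAlgebra.Build R[i] (uba_alg H)
  (fun k x y => esym (uba_mulZr H k x y)).

Definition uba_norm (x : uba_alg H) : R := complex.Re `|x : A|.

Lemma uba_normE (x : A) : `|x| = (uba_norm x)%:C.
Proof. by rewrite RRe_real ?normr_real. Qed.

Lemma uba_algebra_norm : algebra_norm uba_norm.
Proof.
split=> [x y|k x|x y||x x0].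
- by rewrite -lecR rmorphD /= -!uba_normE ler_normD.
- by apply: complexI; rewrite rmorphM /= -modcE -!uba_normE normrZ.
- by rewrite -lecR rmorphM /= -!uba_normE; apply: uba_norm_mul H _ _.
- by apply: complexI; rewrite -uba_normE; apply: uba_norm1 H.
by apply/eqP; rewrite -normr_eq0 uba_normE x0.
Qed.

End UbaAlg.

Theorem theorem2p3 (R : realType) (A : completeNormedModType R[i])
    (mul : A -> A -> A) (one : A) (c : int -> A) :
  unital_banach_algebra mul one ->
  bounded_cosine_sequence mul one c ->
  (exists lam : R[i], spectrum mul one (c 1) = [set lam]) ->
  (forall n : nat, (1 <= n)%N -> exists a : R[i], c n%:Z = a *: one) /\
  (exists b : R, forall n : nat, (1 <= n)%N ->
      c n%:Z = (cos (n%:R * b))%:C *: one).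
Proof.
move=> H [c0 crec [M cM]] [lam spec].
suff [b cb] : exists b : R, forall n : nat, c n%:Z = (cos (n%:R * b))%:C *: one.
  by split=> [n _|]; [exists (cos (n%:R * b))%:C | exists b].
apply: (@bounded_cosine_algebra _ (uba_alg H) _ (fun n : nat => c n%:Z) lam M
  (uba_algebra_norm H)) => //.
- move=> n; have := crec n.+1%:Z 1.
  by rewrite -PoszD addn1 -[X in c (X%:Z - 1)]addn1 PoszD addrK.
- by move=> n; rewrite -lecR -uba_normE.
move=> z zl; have : ~ spectrum mul one (c 1) z by rewrite spec => /eqP; apply/negP.
(* The spectrum is defined through c_1 - z and the resolvent through z - c_1, whence the sign. *)
move=> /contrapT[y [xy yx]]; exists (- (y : uba_alg H)).
by split; [rewrite mulrN -mulNr opprB | rewrite mulNr -mulrN opprB].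
Qed.
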